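(* Let $G$ and $H$ be finite directed graphs that are regularly diagonal, i.e. $\mathrm{EMH}_{k,\ell}(G)=0$ and $\mathrm{EMH}_{k,\ell}(H)=0$ for all $k\neq \ell$. Then the directed join $G*H$ is regularly diagonal. In particular, the cone $C(G)$ of a regularly diagonal directed graph $G$ is regularly diagonal.
   Context: $R$ is a fixed commutative unital ring. A directed graph $G$ has vertex set $V(G)$ and edge set $E(G)\subseteq V(G)\times V(G)$; $d_G(x,y)$ is the minimal length of a directed path from $x$ to $y$ ($\infty$ if there is none), and $\mathrm{len}(x_0,\dots,x_k)=\sum_{i=0}^{k-1}d_G(x_i,x_{i+1})$ when all terms are finite. $\mathrm{EMC}_{k,\ell}(G)$ is the free $R$-module on tuples $(x_0,\dots,x_k)$ of pairwise distinct vertices with $d_G(x_i,x_{i+1})<\infty$ for all $i$ and length $\ell$; $\partial=\sum_{i=1}^{k-1}(-1)^i\partial_i$, where $\partial_i$ deletes $x_i$ if the resulting tuple still has length $\ell$ and is $0$ otherwise; $\mathrm{EMH}_{k,\ell}(G)=H_k(\mathrm{EMC}_{*,\ell}(G),\partial)$. The directed join $G*H$ is the directed graph with vertex set $V(G)\sqcup V(H)$ and edge set $E(G)\sqcup E(H)\sqcup\{(x,y)\mid x\in V(G),\,y\in V(H)\}$. The cone $C(G)$ is the directed graph obtained from $G$ by adding one extra vertex $\star$ and all directed edges $(x,\star)$ for $x\in V(G)$. *)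

(* Defs.v *)
From HB Require Import structures.
From mathcomp Require Import all_boot all_order all_algebra.
From mathcomp Require Import boolp.

Set Implicit Arguments.
Unset Strict Implicit.
Unset Printing Implicit Defensive.

Import GRing.Theory.
Local Open Scope ring_scope.
Local Open Scope quotient_scope.

(* ker f / (im g :&: ker f), with its module structure; for a complex
   (f \o g = 0) this is ker f / im g. *)
Section Homology.
Variables (R : pzRingType) (W U V : lmodType R).
Variables (g : {linear W -> U}) (f : {linear U -> V}).

Definition in_ker : pred U := fun u => f u == 0.

Fact in_ker_submod : GRing.subsemimod_closed in_ker.
Proof.
split; first split.
- by rewrite unfold_in /in_ker raddf0.
- by move=> u v /eqP fu /eqP fv; rewrite unfold_in /in_ker raddfD /= fu fv addr0.
- by move=> a u /eqP fu; rewrite unfold_in /in_ker linearZ /= fu scaler0.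
Qed.
HB.instance Definition _ := GRing.isSubmodClosed.Build R U in_ker in_ker_submod.

Record cycles := Cycle { cycle_val : U; _ : cycle_val \in in_ker }.
HB.instance Definition _ := [isSub for cycle_val].
HB.instance Definition _ := [Choice of cycles by <:].
HB.instance Definition _ := [SubChoice_isSubLmodule of cycles by <:].

(* Membership in an image is undecidable over a general ring, while quotients
   are taken by boolean predicates; hence the classical truth value. *)
Definition in_im : pred cycles := fun z => `[< exists w : W, g w = cycle_val z >].

Fact in_im_submod : GRing.subsemimod_closed in_im.
Proof.
split; first split.
- by apply/asboolP; exists 0; rewrite raddf0.
- move=> y z /asboolP[v gv] /asboolP[w gw]; apply/asboolP.
  by exists (v + w); rewrite raddfD /= gv gw.
- move=> a z /asboolP[w gw]; apply/asboolP.
  by exists (a *: w); rewrite linearZ /= gw.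
Qed.
HB.instance Definition _ := GRing.isSubmodClosed.Build R cycles in_im in_im_submod.

Definition homology : Type := Quotient.quot (GRing.ZmodClosed.clone cycles in_im _).
HB.instance Definition _ := GRing.Zmodule.on homology.

Definition homology_scale (a : R) (x : homology) : homology :=
  \pi_homology (a *: repr x).

Fact homology_scale_pi a (z : cycles) :
  homology_scale a (\pi_homology z) = \pi_homology (a *: z).
Proof.
apply/eqP; rewrite /homology_scale -Quotient.idealrBE -scalerBr.
by apply: rpredZ; rewrite Quotient.idealrBE reprK.
Qed.

Fact homology_scaleA a b x :
  homology_scale a (homology_scale b x) = homology_scale (a * b) x.
Proof. by rewrite -[x]reprK (homology_scale_pi b) !homology_scale_pi scalerA. Qed.

Fact homology_scale1 : left_id 1 homology_scale.
Proof. by move=> x; rewrite -[x]reprK homology_scale_pi scale1r. Qed.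

Fact homology_scaleDr : right_distributive homology_scale +%R.
Proof.
move=> a x y; rewrite -[x]reprK -[y]reprK !homology_scale_pi -!raddfD /=.
by rewrite homology_scale_pi scalerDr raddfD.
Qed.

Fact homology_scaleDl x : {morph homology_scale^~ x : a b / a + b}.
Proof.
by move=> a b; rewrite -[x]reprK !homology_scale_pi scalerDl raddfD.
Qed.

HB.instance Definition _ := GRing.Zmodule_isLmodule.Build R homology
  homology_scaleA homology_scale1 homology_scaleDr homology_scaleDl.

Lemma homology_eq0P :
  (forall h : homology, h = 0) <->
  (forall u : U, f u = 0 -> exists w : W, g w = u).
Proof.
split=> [H0 u /eqP fu|exact h].
  have /eqP := H0 (\pi_homology (Cycle (fu : u \in in_ker))).
  by rewrite -[0](raddf0 \pi_homology) -Quotient.idealrBE subr0 => /asboolP.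
rewrite -[h]reprK -[RHS](raddf0 \pi_homology); apply/eqP.
rewrite -Quotient.idealrBE subr0; apply/asboolP; apply: exact.
by case: (repr h) => u fu; apply/eqP: fu.
Qed.

End Homology.

(* Loops are allowed, as E(G) is an arbitrary subset of V(G) x V(G). *)
Record digraph := Digraph { vertex :> finType; edge : rel vertex }.

Section Magnitude.
Variables (G : digraph).
Implicit Types x y z : G.

Definition has_walk x y (n : nat) : bool :=
  [exists p : n.-tuple G, path (@edge G) x p && (last x p == y)].

Fact connect_has_walk x y : connect (@edge G) x y -> exists n, has_walk x y n.
Proof.
by case/connectP=> p pth lst; exists (size p); apply/existsP;
   exists (in_tuple p); rewrite pth lst eqxx.
Qed.

(* [None] stands for infinity, here and in [len]. *)
Definition dist x y : option nat :=
  match @idP (connect (@edge G) x y) with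
  | ReflectT xy => Some (ex_minn (connect_has_walk xy))
  | ReflectF _ => None
  end.

Fixpoint len_from x (s : seq G) : option nat :=
  if s is y :: s' then
    if (dist x y, len_from y s') is (Some m, Some n) then Some (m + n)%N
    else None
  else Some 0%N.

Definition len (s : seq G) : option nat :=
  if s is x :: s' then len_from x s' else Some 0%N.

Definition is_gen (k l : nat) (t : k.+1.-tuple G) : bool :=
  uniq t && (len t == Some l).

Definition gen (k l : nat) : finType := {t : k.+1.-tuple G | is_gen l t}.

Definition gen_seq (k l : nat) (t : gen k l) : seq G := val (val t).

Definition del (i : nat) (s : seq G) : seq G := take i s ++ drop i.+1 s.

Lemma dist_has_walk x y n : has_walk x y n ->
  exists2 m, dist x y = Some m & (m <= n)%N.
Proof.
move=> w; rewrite /dist; case: {-}_ / idP => [xy|[]].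
  by eexists; [reflexivity | case: ex_minnP => m _; apply].
case/existsP: w => p /andP[pth /eqP lst].
by apply/connectP; exists p.
Qed.

Lemma has_walk_dist x y m : dist x y = Some m -> has_walk x y m.
Proof.
rewrite /dist; case: {-}_ / idP => // xy [<-].
by case: ex_minnP.
Qed.

Lemma dist_triangle x y z m n : dist x y = Some m -> dist y z = Some n ->
  exists2 r, dist x z = Some r & (r <= m + n)%N.
Proof.
move=> /has_walk_dist/existsP[p /andP[p1 /eqP p2]].
move=> /has_walk_dist/existsP[q /andP[q1 /eqP q2]].
apply: dist_has_walk; apply/existsP; exists (cat_tuple p q).
by rewrite /= cat_path last_cat p1 p2 q1 q2 eqxx.
Qed.

Lemma del0 x (s : seq G) : del 0 (x :: s) = s.
Proof. by rewrite /del /= drop0. Qed.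

Lemma delS x (s : seq G) i : del i.+1 (x :: s) = x :: del i s.
Proof. by []. Qed.

Lemma len_del (s : seq G) i l : (0 < i)%N -> (i.+1 < size s)%N ->
  len s = Some l -> exists2 l', len (del i s) = Some l' & (l' <= l)%N.
Proof.
case: s => [|x s] //; case: i => // i _; rewrite delS !ltnS /len.
elim: s x i l => [|y s IH] x i l //=; rewrite ltnS.
case: i => [|i].
  rewrite del0; case: s {IH} => [|z s] //= _.
  case E1: (dist x y) => [a|] //; case E2: (dist y z) => [b|] //.
  case: (len_from z s) => [c|] // [<-].
  have [r -> ler] := dist_triangle E1 E2.
  by exists (r + c)%N => //; rewrite addnA leq_add2r.
rewrite delS /= => hi.
case E1: (dist x y) => [a|] //; case E2: (len_from y s) => [b|] // [<-].
have [r -> ler] := IH _ _ _ hi E2.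
by exists (a + r)%N => //; rewrite leq_add2l.
Qed.

Lemma del_del (s : seq G) i j : (i < j)%N -> (j < size s)%N ->
  del i (del j s) = del j.-1 (del i s).
Proof.
elim: s i j => [|x s IH] i [|j] //; case: i => [|i]; rewrite delS !ltnS.
  by rewrite !del0.
by case: j => // j ij js; rewrite !delS IH.
Qed.

Lemma del_subseq (s : seq G) i : subseq (del i s) s.
Proof.
rewrite /del -{3}(cat_take_drop i s) cat_subseq //.
by rewrite -[i.+1]add1n -drop_drop drop_subseq.
Qed.

Lemma size_del (s : seq G) i : (i < size s)%N -> size (del i s) = (size s).-1.
Proof.
elim: s i => [|x s IH] [|i] //; first by rewrite del0.
by rewrite delS ltnS /= => h; rewrite IH // prednK //; apply: leq_trans h.
Qed.

Variable R : comPzRingType.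

(* Chains are coordinate functions on the finite basis of generators. *)
Definition EMC (k l : nat) : lmodType R := {ffun gen k l -> R^o}.

Section Boundary.
Variables (k l : nat).

(* The linear extension of "delete x_i": as [s] ranges over generators of
   length [l], a generator [t] such that [del i t] has another length
   contributes nothing. *)
Definition face (i : nat) (c : EMC k l) : EMC k.-1 l :=
  [ffun s => \sum_(t : gen k l | del i (gen_seq t) == gen_seq s) c t].

(* For [k = 0] the sum is empty, so this is the zero map, as it should be even
   though its codomain is then [EMC 0 l]. *)
Definition boundary (c : EMC k l) : EMC k.-1 l :=
  \sum_(1 <= i < k) (-1) ^+ i *: face i c.

Fact face_is_linear i : linear (face i).
Proof.
move=> a c d; apply/ffunP=> s; rewrite !ffunE scaler_sumr -big_split /=.
by apply: eq_bigr => t _; rewrite !ffunE.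
Qed.

HB.instance Definition _ i :=
  GRing.isLinear.Build R (EMC k l) (EMC k.-1 l) *:%R (face i) (face_is_linear i).

Fact boundary_is_linear : linear boundary.
Proof.
move=> a c d; rewrite /boundary scaler_sumr -big_split /=.
apply: eq_bigr => i _; rewrite face_is_linear scalerDr !scalerA.
by rewrite mulrC.
Qed.
HB.instance Definition _ :=
  GRing.isLinear.Build R (EMC k l) (EMC k.-1 l) *:%R boundary boundary_is_linear.

End Boundary.

Lemma size_gen k l (t : gen k l) : size (gen_seq t) = k.+1.
Proof. exact: size_tuple. Qed.

Lemma gen_seq_inj k l : injective (@gen_seq k l).
Proof. by move=> s t /val_inj/val_inj. Qed.

Lemma gen_seqP k l (s : seq G) : size s = k.+1 -> uniq s -> len s = Some l ->
  exists t : gen k l, gen_seq t = s.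
Proof.
move=> /eqP ss us ls.
have h : is_gen l (Tuple ss) by rewrite /is_gen /= us ls eqxx.
by exists (Sub (Tuple ss) h); rewrite /gen_seq SubK.
Qed.

Lemma face_face k l i j (c : EMC k.+1 l) (s : gen k.-1 l) :
  (0 < i < k)%N -> (0 < j < k.+1)%N ->
  face (k := k) i (face j c) s =
  \sum_(u : gen k.+1 l | del i (del j (gen_seq u)) == gen_seq s) c u.
Proof.
move=> /andP[i0 ik] /andP[j0 jk]; rewrite ffunE.
under eq_bigr => t _ do rewrite ffunE.
rewrite (exchange_big_dep
  (fun u : gen k.+1 l => del i (del j (gen_seq u)) == gen_seq s)) /=;
  [|by move=> t u /eqP <- /eqP ->].
apply: eq_bigr => u /eqP us.
have /andP[uu /eqP lu] : is_gen l (val u) := valP u.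
have sd : size (del j (gen_seq u)) = k.+1.
  by rewrite size_del size_gen //; apply: ltnW.
have ju : (j.+1 < size (gen_seq u))%N by rewrite size_gen ltnS.
have iu : (i.+1 < size (del j (gen_seq u)))%N by rewrite sd ltnS.
have [l' ld lel'] := len_del j0 ju lu.
have [l'' ld' lel''] := len_del i0 iu ld.
have /andP[_ /eqP ls] : is_gen l (val s) := valP s.
have e : l' = l.
  apply/eqP; rewrite eqn_leq lel' /=.
  by move: ld'; rewrite us /gen_seq ls => - [->].
have [t tE] : exists t : gen k l, gen_seq t = del j (gen_seq u).
  apply: gen_seqP => //; first exact: subseq_uniq (del_subseq _ _) uu.
  by rewrite ld e.
apply: (big_pred1 t) => t' /=; rewrite -tE (inj_eq (@gen_seq_inj _ _)).
rewrite [t' == t]eq_sym; case: (t =P t') => [<-|_]; rewrite ?andbF //.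
by rewrite tE us eqxx.
Qed.

Lemma boundary_boundary k l (c : EMC k.+1 l) : boundary (k := k) (boundary c) = 0.
Proof.
pose D i j : EMC k.-1 l := face (k := k) i (face j c).
have DE i j : (0 < i < j)%N -> (j < k.+1)%N -> D i j = D j.-1 i.
  move=> /andP[i0 ij] jk; apply/ffunP=> s.
  have j0 : (0 < j)%N := leq_ltn_trans (leq0n i) ij.
  have j1 : (0 < j.-1)%N by rewrite -ltnS prednK //; apply: leq_trans ij.
  have jk1 : (j.-1 < k)%N by rewrite -ltnS prednK.
  have ik : (i < k)%N by apply: leq_trans ij _.
  rewrite !face_face ?i0 ?j0 ?j1 ?ltnS ?(ltnW ik) //.
  by apply: eq_bigl => u; rewrite del_del // size_gen ltnW.
transitivity
   ( \sum_(1 <= i < k) \sum_(1 <= j < k.+1) (-1) ^+ (i + j) *: D i j).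
  rewrite {1}/boundary; apply: eq_bigr => i _.
  rewrite /boundary linear_sum scaler_sumr; apply: eq_bigr => j _.
  by rewrite linearZ /= scalerA exprD.
have split_at i : (1 <= i < k)%N ->
    \sum_(1 <= j < k.+1) (-1) ^+ (i + j) *: D i j =
    \sum_(1 <= j < k | (j <= i)%N) (-1) ^+ (i + j) *: D i j
    - \sum_(1 <= j < k | (i <= j)%N) (-1) ^+ (i + j) *: D j i.
  case/andP=> i0 ik; rewrite (@big_cat_nat _ _ _ i.+1) //= ?ltnS 1?ltnW //.
  congr (_ + _).
    rewrite (@big_cat_nat _ _ _ i.+1 1 k) //= [X in _ + X]big_nat_cond.
    rewrite [X in _ + X]big_pred0 ?addr0; last first.
      by move=> j; case: (ltngtP i j); rewrite ?andbF.
    rewrite big_nat_cond [RHS]big_nat_cond; apply: eq_bigl => j.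
    by rewrite ltnS; case: (j <= i)%N; rewrite ?andbF ?andbT.
  rewrite big_add1 /= (@big_cat_nat _ _ _ i 1 k) //= ?(ltnW ik) //.
  rewrite [X in - (X + _)]big_nat_cond.
  rewrite [X in - (X + _)]big_pred0 ?add0r; last first.
    by move=> j; case: (ltngtP i j); rewrite ?andbF.
  rewrite big_nat_cond [in RHS]big_nat_cond -sumrN.
  apply: eq_big => [j|j /andP[/andP[ij jk] _]].
    by case: (i <= j)%N; rewrite ?andbT ?andbF.
  by rewrite DE ?i0 ?ltnS //= addnS exprS mulN1r scaleNr.
rewrite (eq_big_nat _ _ split_at) sumrB; apply/eqP; rewrite subr_eq0; apply/eqP.
rewrite (exchange_big_dep_nat (fun j => (1 <= j < k)%N)) //=.
rewrite [RHS]big_nat_cond; apply: eq_big => [j|j _]; first by rewrite andbT.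
by apply: eq_bigr => i _; rewrite addnC.
Qed.

Definition EMH (k l : nat) : lmodType R :=
  homology (@boundary k.+1 l) (@boundary k l).

Definition regularly_diagonal : Prop :=
  forall k l : nat, k <> l -> forall h : EMH k l, h = 0.

End Magnitude.

Arguments regularly_diagonal G R : clear implicits.
Arguments EMC G R k l : clear implicits.
Arguments EMH G R k l : clear implicits.

Definition join_edge (G H : digraph) : rel (G + H)%type := fun a b =>
  match a, b with
  | inl x, inl y => edge x y
  | inr x, inr y => edge x y
  | inl _, inr _ => true
  | inr _, inl _ => false
  end.

Definition join (G H : digraph) : digraph := Digraph (@join_edge G H).

(* The apex is [None]. *)
Definition cone_edge (G : digraph) : rel (option G) := fun a b =>
  match a, b with
  | Some x, Some y => edge x y
  | Some _, None => true
  | None, _ => false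
  end.

Definition cone (G : digraph) : digraph := Digraph (@cone_edge G).

(* Main.v *)
Require Import Defs.
From mathcomp Require Import all_boot all_order all_algebra.
From mathcomp Require Import boolp zify.

(* Augment the complex of a digraph by the empty tuple and shift degree and
   length by one. Every directed distance from G to H in G * H is 1 and every
   one from H to G is infinite, so the augmented complex of G * H is the tensor
   product of those of G and H, with additive length. Grade by the excess
   (length minus degree), which is nonnegative and is raised by one by the
   differential: a digraph is regularly diagonal when its complex is exact in
   positive excess. The complexes are free and bounded, so such exactness of one
   factor yields a contraction in positive excess, which reduces a cycle of the
   tensor product to cycles of the other factor. The cone is the join with a
   point. *)

Set Implicit Arguments.
Unset Strict Implicit.
Unset Printing Implicit Defensive.

Import GRing.Theory.
Local Open Scope ring_scope.

(** * Exactness in positive weight *)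

Section Contraction.
Variables (R : comPzRingType) (X : finType) (d : X -> X -> R) (wt : X -> nat).

(** [d x y] is the coefficient of the basis element [x] in the differential of [y], so the sums are
    matrix products. Chains may mix weights. *)
Definition exact_above0 : Prop := forall c : X -> R,
  (forall x, \sum_y d x y * c y = 0) -> (forall x, wt x = 0%N -> c x = 0) ->
  exists w : X -> R, forall x, \sum_y d x y * w y = c x.

Lemma mulr_sum_exchange (I J : finType) (a : I -> R) (b : I -> J -> R) (c : J -> R) :
  \sum_i a i * (\sum_j b i j * c j) = \sum_j (\sum_i a i * b i j) * c j.
Proof.
under eq_bigr do rewrite mulr_sumr; rewrite exchange_big /=.
by apply: eq_bigr => j _; rewrite mulr_suml; apply: eq_bigr => i _; rewrite mulrA.
Qed.

Lemma sum_deltal (I : finType) (i : I) (c : I -> R) :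
  \sum_j (i == j)%:R * c j = c i.
Proof.
rewrite (bigD1 i) //= eqxx mul1r big1 ?addr0 // => j ji.
by rewrite eq_sym (negbTE ji) mul0r.
Qed.

Lemma sum_deltar (I : finType) (i : I) (c : I -> R) :
  \sum_j c j * (j == i)%:R = c i.
Proof.
by rewrite -[RHS](sum_deltal i); apply: eq_bigr => j _; rewrite mulrC eq_sym.
Qed.

Hypothesis dd0 : forall x z, \sum_y d x y * d y z = 0.
Hypothesis dwt : forall x y, wt x <> (wt y).+1 -> d x y = 0.

(** Where [h] already contracts, [d h d = (1 - h d) d = d] because [d d = 0]; hence [1 - h d] sends
    [z] to a cycle. Only columns one weight above [z] enter. *)
Lemma contraction_defect_cycle (h : X -> X -> R) z :
  (forall x y, wt y = (wt z).+1 ->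
    \sum_u d x u * h u y + \sum_u h x u * d u y = (x == y)%:R) ->
  forall x, \sum_y d x y * ((y == z)%:R - \sum_u h y u * d u z) = 0.
Proof.
move=> hz x; under eq_bigr do rewrite mulrBr.
rewrite sumrB sum_deltar mulr_sum_exchange.
rewrite (eq_bigr (fun y => ((x == y)%:R - \sum_u h x u * d u y) * d y z)); last first.
  move=> y _; have [e|/eqP ne] := eqVneq (wt y) (wt z).+1; last by rewrite dwt ?mulr0.
  by rewrite -(hz x y e) addrK.
under eq_bigr do rewrite mulrBl.
rewrite sumrB sum_deltal -mulr_sum_exchange.
by rewrite [X in _ - (_ - X)]big1 ?subr0 ?subrr // => u _; rewrite dd0 mulr0.
Qed.

(** Since [d] raises weight by exactly one, only the weight [n] part of a preimage reaches weight
    [n.+1]; the rest can be cut off. *)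
Lemma exact_above0_homogeneous n (c : X -> R) : exact_above0 ->
  (forall x, \sum_y d x y * c y = 0) -> (forall x, wt x <> n.+1 -> c x = 0) ->
  exists w : X -> R, (forall x, wt x <> n -> w x = 0) /\
    forall x, \sum_y d x y * w y = c x.
Proof.
move=> ex dc cn; have [|w wE] := ex c dc; first by move=> x x0; rewrite cn // x0.
exists (fun x => if wt x == n then w x else 0); split=> x; first by move=> /eqP/negbTE ->.
have [e|/eqP ne] := eqVneq (wt x) n.+1.
  rewrite -wE; apply: eq_bigr => y _; case: eqP => // ne.
  by rewrite dwt ?mul0r // e => -[/esym].
rewrite cn //; apply: big1 => y _; case: eqP => [e|]; last by rewrite mulr0.
by rewrite dwt ?mul0r ?e.
Qed.

(** Descending induction on the weight of the column [z]: beyond the maximal weight there are no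
    columns, and at each stage exactness gives a preimage of the cycle [z - h d z], chosen
    separately for each basis element. *)
Lemma exact_above0_contraction : exact_above0 ->
  exists h : X -> X -> R, (forall x z, wt z <> (wt x).+1 -> h x z = 0) /\
    forall x z, (0 < wt z)%N ->
      \sum_y d x y * h y z + \sum_y h x y * d y z = (x == z)%:R.
Proof.
move=> ex; pose N := (\max_x wt x).+1.
suff [h [h1 h2]] : exists h : X -> X -> R,
    (forall x z, wt z <> (wt x).+1 -> h x z = 0) /\
    forall x z, (0 < wt z)%N -> (N <= wt z + N)%N ->
      \sum_y d x y * h y z + \sum_y h x y * d y z = (x == z)%:R.
  by exists h; split=> // x z z0; apply: h2; rewrite ?leq_addl.
(* After [n] steps the columns of positive weight at least [N - n] are done. *)
elim: {2}N => [|n [h [h1 h2]]].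
  exists (fun _ _ => 0); split=> // x z _.
  by rewrite addn0 leqNgt ltnS leq_bigmax.
have /choice [w wP] : forall z, exists w : X -> R,
    (forall x, wt z <> (wt x).+1 -> w x = 0) /\
    ((0 < wt z)%N -> (N <= wt z + n.+1)%N -> forall x,
      \sum_y d x y * w y = (x == z)%:R - \sum_y h x y * d y z).
  move=> z; case: (posnP (wt z)) => [z0|z0]; first by exists (fun=> 0).
  have [Nz|Nz] := boolP (N <= wt z + n.+1)%N; last by exists (fun=> 0).
  have [|x xz|w [w1 w2]] := @exact_above0_homogeneous (wt z).-1
    (fun x => (x == z)%:R - \sum_y h x y * d y z) ex.
  - apply: contraction_defect_cycle => x y yz; apply: h2; first by rewrite yz.
    by rewrite yz addSnnS.
  - rewrite prednK // in xz.
    rewrite (_ : x == z = false); last by apply/eqP=> e; rewrite e in xz.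
    rewrite sub0r big1 ?oppr0 // => y _.
    have [e|/eqP ne] := eqVneq (wt y) (wt z).+1; last by rewrite dwt ?mulr0.
    by rewrite h1 ?mul0r // e => -[/esym].
  - exists w; split=> // x xz; apply: w1 => e.
    by apply: xz; rewrite e prednK.
(* Finished columns keep their values. For [z] of a weight covered now, [d z] lies one weight
   higher, among finished columns, so [h d z] does not change. *)
pose top z := (N <= wt z + n)%N.
exists (fun x z => if top z then h x z else w z x); split=> [x z ne|x z z0 Nz].
  by case: ifP => _; [exact: h1|apply: (wP z).1].
have -> : \sum_y (if top y then h x y else w y x) * d y z = \sum_y h x y * d y z.
  apply: eq_bigr => y _.
  have [e|/eqP ne] := eqVneq (wt y) (wt z).+1; last by rewrite dwt ?mulr0.
  by rewrite /top e addSnnS Nz.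
have [tz|_] := boolP (top z); first exact: h2.
by rewrite (wP z).2 // subrK.
Qed.

End Contraction.

(** * Exactness of a tensor product of complexes *)

Section Tensor.
Variables (R : comPzRingType) (X Y : finType).
Variables (d : X -> X -> R) (wt : X -> nat) (sg : X -> R).
Variables (d' : Y -> Y -> R) (wt' : Y -> nat).
Hypothesis sg2 : forall x, sg x * sg x = 1.
Hypothesis sgd : forall x x', d x x' * sg x' = - (sg x * d x x').
Hypothesis dd0 : forall x z, \sum_y d' x y * d' y z = 0.
Hypothesis dwt : forall x y, wt' x <> (wt' y).+1 -> d' x y = 0.

(* With [h] a contraction of the second factor, [P = 1 - d' h - h d'] is
   supported on the columns of weight 0, where the slices of a cycle are
   cycles of the first factor, so only the second factor has to be split. *)
Lemma exact_above0_tensor (c : X -> Y -> R) :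
  exact_above0 d wt -> exact_above0 d' wt' ->
  (forall x y, \sum_x' d x x' * c x' y + sg x * \sum_y' d' y y' * c x y' = 0) ->
  (forall x y, wt x = 0%N -> wt' y = 0%N -> c x y = 0) ->
  exists w : X -> Y -> R, forall x y,
    \sum_x' d x x' * w x' y + sg x * \sum_y' d' y y' * w x y' = c x y.
Proof.
move=> exX exY dc c0.
have [h [hwt hE]] := exact_above0_contraction dd0 dwt exY.
(* No entry of [d'] lands in weight 0, so there the slice of [c] at [y] is a cycle of the first
   factor, and [v y] is a preimage of it. *)
have /choice [v vP] : forall y, exists v : X -> R,
    wt' y = 0%N -> forall x, \sum_x' d x x' * v x' = c x y.
  move=> y; have [y0|/eqP ne] := eqVneq (wt' y) 0%N; last by exists (fun=> 0).
  have [x||v vE] := exX (fun x => c x y); [|by move=> x x0; exact: c0|by exists v].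
  rewrite -[RHS](dc x y) [X in _ = _ + _ * X]big1 ?mulr0 ?addr0 // => y' _.
  by rewrite dwt ?mul0r // y0.
pose P y z : R :=
  if wt' z == 0%N then (y == z)%:R - \sum_u h y u * d' u z else 0.
have PE y z : \sum_u d' y u * h u z + \sum_u h y u * d' u z + P y z = (y == z)%:R.
  rewrite /P; case: (posnP (wt' z)) => z0; last first.
    by rewrite hE // addr0.
  rewrite big1 ?add0r 1?addrC ?subrK // => u _.
  by rewrite hwt ?mulr0 // z0.
have dP y z : \sum_u d' y u * P u z = 0.
  rewrite /P; case: eqP => [z0|_]; last by rewrite big1 // => u _; rewrite mulr0.
  by apply: (contraction_defect_cycle dd0 dwt) => x u uz; apply: hE; rewrite uz.
(* The total differential of [sg * h c] is [h d' c + d' h c]: the cycle condition turns [d c] into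
   [- sg * d' c], and the signs cancel. That of [P v] is [P c], as [d' P = 0] and [d v = c] in
   weight 0. By [PE] the sum is [c]. *)
exists (fun x y => sg x * (\sum_y' h y y' * c x y') + \sum_y' P y y' * v y' x).
move=> x y.
under eq_bigr do rewrite mulrDr mulrA sgd mulNr -mulrA.
under [X in _ + _ * X]eq_bigr do rewrite mulrDr mulrCA.
rewrite !big_split /= !sumrN -!mulr_sumr mulrDr !mulr_sum_exchange.
rewrite [X in _ + (_ + _ * X)]big1; last by move=> z _; rewrite dP mul0r.
rewrite mulr0 addr0 mulrA sg2 mul1r.
have -> : \sum_x' d x x' * (\sum_y' h y y' * c x' y') =
          - (sg x * \sum_z (\sum_u h y u * d' u z) * c x z).
  rewrite -mulr_sum_exchange mulr_sumr -sumrN.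
  under eq_bigr do rewrite mulr_sumr.
  rewrite exchange_big /=; apply: eq_bigr => u _.
  under eq_bigr do rewrite mulrCA.
  rewrite -mulr_sumr; have /eqP := dc x u; rewrite addr_eq0 => /eqP ->.
  by rewrite mulrN mulrCA.
rewrite mulrN opprK mulrA sg2 mul1r.
have -> : \sum_x' d x x' * (\sum_y' P y y' * v y' x') = \sum_z P y z * c x z.
  under eq_bigr do rewrite mulr_sumr.
  rewrite exchange_big /=; apply: eq_bigr => u _.
  under eq_bigr do rewrite mulrCA.
  rewrite -mulr_sumr /P; case: eqP => [u0|_]; last by rewrite !mul0r.
  by rewrite vP.
rewrite -!big_split /= -[RHS](sum_deltal y); apply: eq_bigr => z _.
by rewrite -PE -!mulrDl addrC addrA.
Qed.

End Tensor.

(** * The augmented complex *)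

Definition oadd (a b : option nat) : option nat :=
  if (a, b) is (Some m, Some n) then Some (m + n)%N else None.

Lemma oaddA : associative oadd.
Proof. by case=> [a|] [b|] [c|] //=; rewrite /oadd addnA. Qed.

Lemma oadd0r a : oadd (Some 0%N) a = a.
Proof. by case: a. Qed.

Lemma del_cat (G : digraph) (s t : seq G) i :
  del i (s ++ t) = if (i < size s)%N then del i s ++ t else s ++ del (i - size s) t.
Proof.
elim: s i => [|x s IH] [|i] //=; rewrite ?subn0 ?del0 // !delS IH ltnS subSS.
by case: ifP.
Qed.

Lemma map_del (G K : digraph) (f : G -> K) (s : seq G) i : map f (del i s) = del i (map f s).
Proof. by rewrite /del map_cat map_take map_drop. Qed.

Section AugmentedLength.
Variable G : digraph.
Implicit Types (x y : G) (s t : seq G).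

(* The empty tuple gets length 0 and all other lengths are shifted by 1, which
   makes the length additive under directed join. *)
Definition alen s : option nat :=
  if s is [::] then Some 0%N else omap succn (len s).

Lemma alen_cons x s : alen (x :: s) = omap succn (len_from x s).
Proof. by []. Qed.

Lemma len_from_cons x y s : len_from x (y :: s) = oadd (dist x y) (len_from y s).
Proof. by []. Qed.

Lemma len_from_rcons x y s :
  len_from x (rcons s y) = oadd (len_from x s) (dist (last x s) y).
Proof.
elim: s x => [|z s IH] x; last by rewrite rcons_cons !len_from_cons IH oaddA.
by rewrite /= -/(oadd _ _); case: (dist x y) => //= n; rewrite addn0.
Qed.

Lemma dist_gt0 x y n : x != y -> dist x y = Some n -> (0 < n)%N.
Proof.
move=> ne /has_walk_dist/existsP[p /andP[_ /eqP]]; case: n p => // p.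
by rewrite (tuple0 p) /= => e; rewrite e eqxx in ne.
Qed.

(** Consecutive vertices are distinct, hence at distance at least 1. This is what makes the excess
    nonnegative. *)
Lemma size_le_len_from x s n : uniq (x :: s) -> len_from x s = Some n -> (size s <= n)%N.
Proof.
elim: s x n => // y s IH x n /= /andP[]; rewrite inE negb_or => /andP[xy _] u.
case E1: (dist x y) => [a|] //; case E2: (len_from y s) => [b|] // [<-].
have := IH _ _ u E2; have := dist_gt0 xy E1; lia.
Qed.

Lemma size_le_alen s n : uniq s -> alen s = Some n -> (size s <= n)%N.
Proof.
case: s => // x s u; rewrite alen_cons.
by case E: (len_from x s) => [m|] // [<-]; rewrite ltnS; apply: size_le_len_from E.
Qed.

(** The deletion removes a positive first distance or, for a single vertex, drops the augmented
    length from 1 to 0. *)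
Lemma alen_del_first s n : uniq s -> (0 < size s)%N -> alen s = Some n ->
  alen (del 0 s) <> Some n.
Proof.
case: s => // x [|y s] u _; first by move=> [<-].
rewrite del0 !alen_cons len_from_cons.
have xy : x != y by move: u; rewrite /= inE negb_or => /andP[/andP[]].
case E1: (dist x y) => [a|] //; case E2: (len_from y s) => [b|] //= [<-] [].
have := dist_gt0 xy E1; lia.
Qed.

Lemma del_rcons_last s x : del (size s) (rcons s x) = s.
Proof. by rewrite -cats1 del_cat ltnn subnn cats0. Qed.

Lemma alen_del_last s n i : uniq s -> size s = i.+1 -> alen s = Some n ->
  alen (del i s) <> Some n.
Proof.
case/lastP: s => // s y; rewrite size_rcons => u [<-]; rewrite del_rcons_last.
case: s u => [_ [<-] //|x s u].
rewrite rcons_cons !alen_cons len_from_rcons.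
have xy : last x s != y.
  move: u; rewrite rcons_uniq => /andP[+ _]; apply: contraNneq => <-.
  exact: mem_last.
case E1: (len_from x s) => [a|] //; case E2: (dist _ y) => [b|] //= [<-] [].
have := dist_gt0 xy E2; lia.
Qed.

(** One finite basis for all degrees and lengths at once; the entries are distinct, so [#|G|] bounds
    their number. *)
Definition tuples : finType :=
  {s : #|G|.-bseq G | uniq s && (alen s != None :> option nat)}.

Definition tuple_seq (x : tuples) : seq G := val (val x).

Lemma tuple_seq_inj : injective tuple_seq.
Proof. by move=> x y /val_inj/val_inj. Qed.

Lemma tuple_uniq (x : tuples) : uniq (tuple_seq x).
Proof. by case/andP: (valP x). Qed.

Lemma tuple_alen (x : tuples) : exists n, alen (tuple_seq x) = Some n.
Proof.
by case/andP: (valP x) => _; rewrite -/(tuple_seq x); case: alen => // n; exists n.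
Qed.

Lemma tuple_seqP s n : uniq s -> alen s = Some n -> exists x : tuples, tuple_seq x = s.
Proof.
move=> us ls; have ss : (size s <= #|G|)%N by rewrite -(card_uniqP us) max_card.
have h : uniq (Bseq ss) && (alen (Bseq ss) != None :> option nat) by rewrite /= us ls.
by exists (Sub (Bseq ss) h); rewrite /tuple_seq SubK.
Qed.

(** By [size_le_alen] the subtraction is never truncated, and the default 0 is never reached. On
    nonempty tuples the two shifts cancel, leaving length minus degree. *)
Definition excess (x : tuples) : nat := odflt 0%N (alen (tuple_seq x)) - size (tuple_seq x).

End AugmentedLength.
Arguments tuples : clear implicits.

Section AugmentedBoundary.
Variables (G : digraph) (R : comPzRingType).
Implicit Types (x y : tuples G) (s t : seq G).

(* The end deletions [i = 0] and [i = (size t).-1] may be included: they never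
   preserve the augmented length. *)
Definition bd s t : R :=
  \sum_(i < size t | (del i t == s) && (alen s == alen t :> option nat)) (-1) ^+ i.

Definition tbd (x y : tuples G) : R := bd (tuple_seq x) (tuple_seq y).

Lemma bd_eq0 s t : (forall i, (i < size t)%N -> del i t = s -> alen s = alen t -> False) ->
  bd s t = 0.
Proof.
move=> h; apply: big_pred0 => i; apply/negP=> /andP[/eqP e1 /eqP e2].
exact: h (ltn_ord i) e1 e2.
Qed.

Lemma tbd_size x y : size (tuple_seq y) <> (size (tuple_seq x)).+1 -> tbd x y = 0.
Proof.
move=> ne; apply: bd_eq0 => i iy e _; apply: ne.
by rewrite -e size_del // prednK //; apply: leq_trans iy.
Qed.

Lemma tbd_alen x y : alen (tuple_seq x) <> alen (tuple_seq y) -> tbd x y = 0.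
Proof. by move=> ne; apply: bd_eq0. Qed.

Lemma tbd_excess x y : excess x <> (excess y).+1 -> tbd x y = 0.
Proof.
move=> ne; have [sz|/eqP/tbd_size //] := eqVneq (size (tuple_seq y)) (size (tuple_seq x)).+1.
have [le|/eqP/tbd_alen //] := eqVneq (alen (tuple_seq x)) (alen (tuple_seq y)).
case: ne; rewrite /excess sz le.
have [n yn] := tuple_alen y; have := size_le_alen (tuple_uniq y) yn.
rewrite yn /=; lia.
Qed.

End AugmentedBoundary.

(** * Comparison with magnitude homology in each bidegree *)

Section Transfer.
Variables (G : digraph) (R : comPzRingType).

Section Degree.
Variables k l : nat.

Lemma gen_alen (t : gen G k l) : alen (gen_seq t) = Some l.+1.
Proof.
have /andP[_ /eqP] := valP t; rewrite -/(gen_seq t).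
by case: (gen_seq t) (size_gen t) => // x s _ /=; rewrite /alen /len => ->.
Qed.

Lemma gen_uniq (t : gen G k l) : uniq (gen_seq t).
Proof. by case/andP: (valP t). Qed.

Lemma ex_of_gen (t : gen G k l) : exists x : tuples G, tuple_seq x == gen_seq t.
Proof. by have [x xt] := tuple_seqP (gen_uniq t) (gen_alen t); exists x; apply/eqP. Qed.

Definition of_gen (t : gen G k l) : tuples G := xchoose (ex_of_gen t).

Lemma of_genE t : tuple_seq (of_gen t) = gen_seq t.
Proof. exact/eqP/(xchooseP (ex_of_gen t)). Qed.

Lemma of_gen_inj : injective of_gen.
Proof. by move=> s t /(congr1 (@tuple_seq G)); rewrite !of_genE => /gen_seq_inj. Qed.

Lemma of_genP x : size (tuple_seq x) = k.+1 -> alen (tuple_seq x) = Some l.+1 ->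
  exists t, of_gen t = x.
Proof.
move=> sx lx; have [|t tx] := @gen_seqP G k l (tuple_seq x) sx (tuple_uniq x).
  by move: lx sx; case: (tuple_seq x) => //= y s; case: (len_from y s) => // n [->].
by exists t; apply: tuple_seq_inj; rewrite of_genE.
Qed.

Lemma sum_of_gen (F : tuples G -> R) :
  (forall x, size (tuple_seq x) <> k.+1 \/ alen (tuple_seq x) <> Some l.+1 -> F x = 0) ->
  \sum_x F x = \sum_t F (of_gen t).
Proof.
move=> F0; transitivity (\sum_(x <- codom of_gen) F x); last by rewrite big_image.
rewrite [RHS]big_uniq; last exact/injectiveP/of_gen_inj.
rewrite [RHS]big_mkcond /=; apply: eq_bigr => x _; case: ifP => // /negP nx.
apply: F0; have [sx|/eqP] := eqVneq (size (tuple_seq x)) k.+1; last by left.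
right=> lx; apply: nx; have [t <-] := of_genP sx lx.
exact: codom_f.
Qed.

Definition restrict (c : tuples G -> R) : EMC G R k l := [ffun t => c (of_gen t)].

(** Extension by zero: [of_gen] is injective, so the sum has at most one term. *)
Definition extend (u : EMC G R k l) (x : tuples G) : R :=
  \sum_(t | of_gen t == x) u t.

Lemma restrict_extend u : restrict (extend u) = u.
Proof.
apply/ffunP=> t; rewrite ffunE; apply: big_pred1 => s.
exact: inj_eq of_gen_inj _ _.
Qed.

Lemma extend_eq0 u x : size (tuple_seq x) <> k.+1 \/ alen (tuple_seq x) <> Some l.+1 ->
  extend u x = 0.
Proof.
move=> h; apply: big_pred0 => t; apply/eqP=> e; move: h.
by rewrite -e of_genE size_gen gen_alen => -[].
Qed.

End Degree.

(** Both sides sum over the same inner deletions, and [tbd] preserves length and changes size by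
    one, so only one bidegree contributes. *)
Lemma boundary_restrict k l (c : tuples G -> R) (s : gen G k l) :
  boundary (restrict k.+1 l c) s = \sum_y tbd R (of_gen s) y * c y.
Proof.
rewrite (@sum_of_gen k.+1 l); last first.
  move=> y h; have [sz|/eqP/tbd_size ->] :=
    eqVneq (size (tuple_seq y)) (size (tuple_seq (of_gen s))).+1; last by rewrite mul0r.
  have [le|/eqP/tbd_alen ->] :=
    eqVneq (alen (tuple_seq (of_gen s))) (alen (tuple_seq y)); last by rewrite mul0r.
  by move: h; rewrite sz -le of_genE size_gen gen_alen => -[].
rewrite /boundary sum_ffunE.
under eq_bigr => i _ do rewrite !ffunE scaler_sumr big_mkcond /=.
rewrite exchange_big /=; apply: eq_bigr => t _.
rewrite /tbd /bd !of_genE.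
rewrite -(big_mkord (fun i => (del i (gen_seq t) == gen_seq s) &&
   (alen (gen_seq s) == alen (gen_seq t))) (fun i => (-1) ^+ i)).
rewrite size_gen !gen_alen eqxx mulr_suml [RHS]big_mkcond /=.
have nz i : alen (del i (gen_seq t)) <> Some l.+1 ->
    del i (gen_seq t) == gen_seq s = false.
  by move=> ne; apply/eqP=> e; apply: ne; rewrite e gen_alen.
(* The end deletions, at indices 0 and [k.+1], occur in [bd] but not in [boundary]; both change the
   length. *)
rewrite [RHS]big_ltn // nz; last first.
  by apply: alen_del_first; rewrite ?gen_uniq ?gen_alen ?size_gen.
rewrite [X in _ + X]big_nat_recr //= nz; last first.
  by apply: alen_del_last; rewrite ?gen_uniq ?gen_alen ?size_gen.
rewrite add0r addr0; apply: eq_bigr => i _; rewrite andbT.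
by case: ifP => // _; rewrite ffunE.
Qed.

Lemma tuple_cases (x : tuples G) :
  tuple_seq x = [::] \/ exists k l (t : gen G k l), x = of_gen t.
Proof.
have [[//|n] xn] := tuple_alen x.
  by have := size_le_alen (tuple_uniq x) xn; rewrite leqn0 => /nilP; left.
case sx: (size (tuple_seq x)) => [|k]; first by left; apply/nilP; rewrite /nilp sx.
by right; exists k, n; have [t <-] := of_genP sx xn; exists t.
Qed.

(** A tuple of augmented length 0 is itself empty and has nothing to delete, so the augmentation map
    is zero. *)
Lemma tbd_nil (x y : tuples G) : tuple_seq x = [::] -> tbd R x y = 0.
Proof.
move=> x0; have [n yn] := tuple_alen y.
apply: bd_eq0 => i iy; rewrite x0 yn => e [n0].
by have := size_le_alen (tuple_uniq y) yn; rewrite -n0 leqNgt (leq_trans _ iy).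
Qed.

Lemma tbd_tbd (x z : tuples G) : \sum_y tbd R x y * tbd R y z = 0.
Proof.
have [x0|[k [l [s ->]]]] := tuple_cases x.
  by apply: big1 => y _; rewrite tbd_nil ?mul0r.
rewrite -boundary_restrict.
suff -> : restrict k.+1 l (fun y => tbd R y z) =
    boundary (restrict k.+2 l (fun y => (y == z)%:R)).
  by rewrite boundary_boundary ffunE.
apply/ffunP=> t; rewrite ffunE boundary_restrict.
by rewrite sum_deltar.
Qed.

Lemma excess_of_gen k l (t : gen G k l) : excess (of_gen t) = (l - k)%N.
Proof. by rewrite /excess of_genE gen_alen size_gen subSS. Qed.

(** A generator of degree [k] and length [l] has excess [l - k], and none exists for [k > l], so
    positive excess means exactly the off-diagonal bidegrees. The empty tuple has excess 0. *)
Lemma regularly_diagonalP :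
  regularly_diagonal G R <-> exact_above0 (@tbd G R) (@excess G).
Proof.
split=> [diag c dc c0|ex k l kl].
  (* Preimages are found bidegree by bidegree: on the diagonal [c] vanishes and 0 works; elsewhere
     the homology is zero. *)
  have fill k l : {w : EMC G R k.+1 l | boundary w = restrict k l c}.
    apply: cid; have [<-|/eqP kl] := eqVneq k l.
      exists 0; rewrite raddf0; apply/ffunP=> t; rewrite !ffunE c0 //.
      by rewrite excess_of_gen subnn.
    have /homology_eq0P := diag k l kl; apply.
    case: k {kl} => [|k]; first by rewrite /= /boundary big_geq.
    by apply/ffunP=> t; rewrite boundary_restrict dc ffunE.
  (* The preimage for bidegree [k], [l] lives in degree [k.+1], on tuples with [k.+2] vertices and
     augmented length [l.+1]; the predecessors undo these shifts. *)
  exists (fun x => extend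
    (sval (fill (size (tuple_seq x)).-2 (odflt 0%N (alen (tuple_seq x))).-1)) x).
  move=> x; have [x0|[k [l [s ->]]]] := tuple_cases x.
    rewrite c0 ?/excess ?x0 //; apply: big1 => y _.
    by rewrite tbd_nil ?mul0r.
  rewrite -boundary_restrict.
  have -> : c (of_gen s) = restrict k l c s by rewrite ffunE.
  rewrite -(svalP (fill k l)); congr (boundary _ _); rewrite -[RHS]restrict_extend.
  by apply/ffunP=> t; rewrite !ffunE of_genE size_gen gen_alen.
apply/homology_eq0P => u bu.
have [x|x x0|w wE] := ex (extend u).
- have [x0|[k' [l' [s ->]]]] := tuple_cases x.
    by apply: big1 => y _; rewrite tbd_nil ?mul0r.
  rewrite -boundary_restrict; have [ek|/eqP nk] := eqVneq k k'.+1; last first.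
    suff -> : restrict k'.+1 l' (extend u) = 0 by rewrite raddf0 ffunE.
    apply/ffunP=> t; rewrite !ffunE extend_eq0 // of_genE size_gen.
    by left=> -[/esym].
  have [el|/eqP nl] := eqVneq l l'; last first.
    suff -> : restrict k'.+1 l' (extend u) = 0 by rewrite raddf0 ffunE.
    apply/ffunP=> t; rewrite !ffunE extend_eq0 // of_genE gen_alen.
    by right=> -[/esym].
  by subst k l; rewrite restrict_extend bu ffunE.
(* Excess 0 gives [l <= k]; with [k <= l] from [size_le_alen] this contradicts [k <> l]. *)
- apply: big_pred0 => t; apply/eqP=> e; move: x0; rewrite -e excess_of_gen => lk.
  have := size_le_alen (gen_uniq t) (gen_alen t); rewrite size_gen; lia.
- exists (restrict k.+1 l w); apply/ffunP=> t.
  by rewrite boundary_restrict wE -[in RHS](restrict_extend u) ffunE.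
Qed.

End Transfer.

(** * Directed joins *)

Lemma dist_eq_walk (G K : digraph) (x y : G) (x' y' : K) :
  (forall n, has_walk x y n <-> has_walk x' y' n) -> dist x y = dist x' y'.
Proof.
move=> h; case E: (dist x y) => [n|]; case E': (dist x' y') => [m|] //.
- have [p Ep np] := dist_has_walk ((h n).1 (has_walk_dist E)).
  have [q Eq mq] := dist_has_walk ((h m).2 (has_walk_dist E')).
  move: Ep Eq; rewrite E E' => -[mp] [nq]; subst p q.
  by congr Some; apply/eqP; rewrite eqn_leq np mq.
- by have [p] := dist_has_walk ((h n).1 (has_walk_dist E)); rewrite E'.
- by have [p] := dist_has_walk ((h m).2 (has_walk_dist E')); rewrite E.
Qed.

(** Each vertex of a walk from [f x] to [f y] is reachable from the start and reaches the end, so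
    the walk stays in the image and lifts along [f]. *)
Lemma dist_convex (G K : digraph) (f : G -> K) (x y : G) : injective f ->
  (forall u v, edge (f u) (f v) = edge u v) ->
  (forall z, connect (@edge K) (f x) z -> connect (@edge K) z (f y) -> z \in codom f) ->
  dist (f x) (f y) = dist x y.
Proof.
move=> fI fe cvx; apply: dist_eq_walk => n; split=> /existsP[p /andP[pp /eqP pl]]; last first.
  apply/existsP; exists (map_tuple f p); rewrite /= last_map pl eqxx andbT.
  by rewrite path_map (eq_path (e' := @edge G)) // => u v; exact: fe.
have cod : {subset (p : seq K) <= codom f}.
  move=> z; case: p pp pl => s _ /= + + zs; case/path.splitP: zs => p1 p2.
  rewrite cat_path last_rcons last_cat last_rcons => /andP[q1 q2] e.
  apply: cvx; apply/connectP; [exists (rcons p1 z)|exists p2] => //.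
  by rewrite last_rcons.
have [q pq] : exists q, p = map f q :> seq K.
  elim: {pp pl}(p : seq K) cod => [|z q IH] cod; first by exists [::].
  have [|q' ->] := IH; first by move=> w wq; apply: cod; rewrite inE wq orbT.
  have /codomP[u ->] : z \in codom f by apply: cod; rewrite mem_head.
  by exists (u :: q').
have sq : size q == n by rewrite -(size_map f) -pq size_tuple.
apply/existsP; exists (Tuple sq) => /=.
move: pp pl; rewrite pq last_map => + /fI -> ; rewrite eqxx andbT.
by rewrite path_map (eq_path (e' := @edge G)) // => u v; exact: fe.
Qed.

Section Join.
Variables (R : comPzRingType) (G H K : digraph) (phi : G + H -> K).
Hypothesis phi_bij : bijective phi.
Hypothesis phi_edge : forall a b, edge (phi a) (phi b) = join_edge a b.

Let f (x : G) : K := phi (inl x).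
Let g (y : H) : K := phi (inr y).

Let phi_inj : injective phi := bij_inj phi_bij.

Let f_inj : injective f. Proof. by move=> x y /phi_inj[]. Qed.
Let g_inj : injective g. Proof. by move=> x y /phi_inj[]. Qed.

Let fg_neq x y : (f x == g y) = false.
Proof. by apply/eqP=> /phi_inj. Qed.

Let phiP z : (exists x, z = f x) \/ (exists y, z = g y).
Proof.
have [psi _ psiK] := phi_bij; rewrite -(psiK z).
by case: (psi z) => w; [left|right]; exists w.
Qed.

Lemma connect_from_right y z : connect (@edge K) (g y) z -> z \in codom g.
Proof.
case/connectP=> p + ->; elim: p y => [|w p IH] y /=; first by rewrite codom_f.
case/andP=> e; have [[x wx]|[y' ->]] := phiP w; last exact: IH.
by rewrite wx phi_edge in e.
Qed.

Lemma connect_to_left x z : connect (@edge K) z (f x) -> z \in codom f.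
Proof.
have [[x' ->]|[y ->]] := phiP z; first by rewrite codom_f.
by move/connect_from_right/codomP=> [y' /eqP]; rewrite fg_neq.
Qed.

(** The image of [G] is closed under predecessors and that of [H] under successors, so both are
    convex. *)
Lemma dist_left x y : dist (f x) (f y) = dist x y.
Proof. by apply: dist_convex => [|u v|z _ /connect_to_left] //; rewrite phi_edge. Qed.

Lemma dist_right x y : dist (g x) (g y) = dist x y.
Proof. by apply: dist_convex => [|u v|z /connect_from_right] //; rewrite phi_edge. Qed.

Lemma dist_right_left y x : dist (g y) (f x) = None.
Proof.
case E: dist => [n|] //; have /existsP[p /andP[pp /eqP pl]] := has_walk_dist E.
have /connect_from_right/codomP[y' /eqP] : connect (@edge K) (g y) (f x).
  by apply/connectP; exists p.
by rewrite fg_neq.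
Qed.

Lemma dist_left_right x y : dist (f x) (g y) = Some 1%N.
Proof.
have [|m E le] := @dist_has_walk K (f x) (g y) 1.
  by apply/existsP; exists [tuple g y]; rewrite /= phi_edge eqxx.
rewrite E; congr Some; apply/eqP; rewrite eqn_leq le /=.
by apply: dist_gt0 E; rewrite fg_neq.
Qed.

Definition cat_join (s : seq G) (t : seq H) : seq K := map f s ++ map g t.

Lemma len_from_map_right y t : len_from (g y) (map g t) = len_from y t.
Proof. by elim: t y => //= z t IH y; rewrite IH dist_right. Qed.

Lemma len_from_cat_join x s t : len_from (f x) (cat_join s t) = oadd (len_from x s) (alen t).
Proof.
elim: s x => [|z s IH] x; last by rewrite /= IH dist_left -oaddA.
rewrite oadd0r; case: t => // y t.
by rewrite alen_cons /= dist_left_right len_from_map_right; case: len_from.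
Qed.

(** When both parts are nonempty, the crossing step of length 1 accounts for the second shift by
    one; an empty part adds neither a step nor a shift. *)
Lemma alen_cat_join s t : alen (cat_join s t) = oadd (alen s) (alen t).
Proof.
case: s => [|x s].
  rewrite oadd0r /cat_join; case: t => // y t.
  by rewrite map_cons cat0s !alen_cons -len_from_map_right.
by rewrite [cat_join _ _]cat_cons !alen_cons len_from_cat_join; case: len_from => // n; case: alen.
Qed.

Lemma uniq_cat_join s t : uniq (cat_join s t) = uniq s && uniq t.
Proof.
rewrite cat_uniq !map_inj_uniq //; congr (_ && _); rewrite -[RHS]andTb; congr (_ && _).
apply/hasPn=> _ /mapP[y _ ->]; apply/negP=> /mapP[x _ /esym/eqP].
by rewrite fg_neq.
Qed.

Lemma cat_join_inj s s' t t' : cat_join s t = cat_join s' t' -> s = s' /\ t = t'.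
Proof.
elim: s s' => [|x s IH] [|x' s'] /=.
- by move/(inj_map g_inj).
- by case: t => //= y t [/esym/eqP]; rewrite fg_neq.
- by case: t' {IH} => //= y t' [/eqP]; rewrite fg_neq.
- by case=> /f_inj -> /IH[-> ->].
Qed.

(** Finite length excludes a step from [H] to [G], so all vertices of [G] come first. *)
Lemma cat_joinP r n : alen r = Some n -> exists s t, r = cat_join s t.
Proof.
elim: r n => [|z r IH] n; first by exists [::], [::].
rewrite alen_cons; case E: len_from => [m|] // _.
have [s [t rE]] : exists s t, r = cat_join s t.
  case: r E IH => [|w r] E IH; first by exists [::], [::].
  move: E; rewrite len_from_cons; case: dist => // a; case E: len_from => [b|] // _.
  by apply: (IH b.+1); rewrite alen_cons E.
have [[x ->]|[y zy]] := phiP z; first by exists (x :: s), t; rewrite rE.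
case: s rE => [|x s] rE; first by exists [::], (y :: t); rewrite rE zy.
by move: E; rewrite zy rE /= dist_right_left.
Qed.

(** Leibniz rule: a deletion acts on one part only, and one in the right part has its index offset
    by [size s'], which produces the sign. *)
Lemma bd_cat_join s s' t t' a b a' b' :
  alen s = Some a -> alen t = Some b -> alen s' = Some a' -> alen t' = Some b' ->
  bd R (cat_join s t) (cat_join s' t') =
  bd R s s' * (t == t')%:R + (-1) ^+ size s' * (s == s')%:R * bd R t t'.
Proof.
move=> sa tb sa' tb'; rewrite /bd /cat_join size_cat !size_map.
rewrite big_split_ord /= mulr_suml mulr_sumr; congr (_ + _).
  rewrite big_mkcond [RHS]big_mkcond /=; apply: eq_bigr => i _.
  rewrite del_cat size_map ltn_ord -map_del.
  have -> : (map f (del i s') ++ map g t' == map f s ++ map g t) =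
            (del i s' == s) && (t == t').
    by apply/eqP/andP=> [/cat_join_inj[-> ->]|[/eqP-> /eqP->]].
  case: (del i s' == s) => //=; case: (t =P t') => [->|_] /=; last by rewrite mulr0 if_same.
  rewrite !alen_cat_join mulr1 sa sa' tb' /oadd.
  (* Lengths add, so the total is preserved exactly when the length of the altered part is. *)
  by congr (if _ then _ else _); apply/eqP/eqP=> -[] ?; congr Some; lia.
rewrite big_mkcond [RHS]big_mkcond /=; apply: eq_bigr => i _.
rewrite del_cat size_map ltnNge leq_addr /= addKn -map_del.
have -> : (map f s' ++ map g (del i t') == map f s ++ map g t) =
          (s == s') && (del i t' == t).
  by apply/eqP/andP=> [/cat_join_inj[-> ->]|[/eqP-> /eqP->]].
case: (s =P s') => [e|_] /=; last by rewrite mulr0 mul0r if_same.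
case: (del i t' == t) => //=; rewrite e !alen_cat_join mulr1 sa' tb tb' exprD /oadd.
by congr (if _ then _ else _); apply/eqP/eqP=> -[] ?; congr Some; lia.
Qed.

Lemma ex_tuple_join (p : tuples G * tuples H) :
  exists z : tuples K, tuple_seq z == cat_join (tuple_seq p.1) (tuple_seq p.2).
Proof.
case: p => x y /=; have [a xa] := tuple_alen x; have [b yb] := tuple_alen y.
have [||z <-] := @tuple_seqP K (cat_join (tuple_seq x) (tuple_seq y)) (a + b).
- by rewrite uniq_cat_join !tuple_uniq.
- by rewrite alen_cat_join xa yb.
- by exists z.
Qed.

Definition tuple_join p : tuples K := xchoose (ex_tuple_join p).

Lemma tuple_joinE p : tuple_seq (tuple_join p) = cat_join (tuple_seq p.1) (tuple_seq p.2).
Proof. exact/eqP/(xchooseP (ex_tuple_join p)). Qed.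

Lemma tuple_join_inj : injective tuple_join.
Proof.
move=> [x y] [x' y'] /(congr1 (@tuple_seq K)); rewrite !tuple_joinE.
by case/cat_join_inj=> /= /tuple_seq_inj -> /tuple_seq_inj ->.
Qed.

Lemma tuple_join_surj z : exists p, tuple_join p = z.
Proof.
have [n zn] := tuple_alen z; have [s [t zE]] := cat_joinP zn.
have := tuple_uniq z; move: zn; rewrite zE uniq_cat_join alen_cat_join.
case Es: alen => [a|] //; case Et: alen => [b|] // _ /andP[us ut].
have [x xs] := tuple_seqP us Es; have [y yt] := tuple_seqP ut Et.
by exists (x, y); apply: tuple_seq_inj; rewrite tuple_joinE /= xs yt zE.
Qed.

Lemma tuple_join_bij : bijective tuple_join.
Proof.
apply: (inj_card_bij tuple_join_inj); rewrite -(card_codom tuple_join_inj).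
apply: subset_leq_card; apply/subsetP=> z _.
by have [p <-] := tuple_join_surj z; apply: codom_f.
Qed.

Lemma excess_tuple_join x y : excess (tuple_join (x, y)) = (excess x + excess y)%N.
Proof.
rewrite /excess tuple_joinE alen_cat_join size_cat !size_map /=.
have [a xa] := tuple_alen x; have [b yb] := tuple_alen y.
have := size_le_alen (tuple_uniq x) xa; have := size_le_alen (tuple_uniq y) yb.
rewrite xa yb /=; lia.
Qed.

(** Under the bijection of bases [tuple_join], the differential of [K] is that of the tensor
    product. *)
Lemma sum_tbd_join x y (c : tuples K -> R) :
  \sum_z tbd R (tuple_join (x, y)) z * c z =
  \sum_x' tbd R x x' * c (tuple_join (x', y)) +
  (-1) ^+ size (tuple_seq x) * \sum_y' tbd R y y' * c (tuple_join (x, y')).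
Proof.
rewrite (reindex tuple_join) /=; last exact: onW_bij _ tuple_join_bij.
rewrite (eq_bigr (fun p => tbd R x p.1 * (y == p.2)%:R * c (tuple_join (p.1, p.2))
  + (-1) ^+ size (tuple_seq p.1) * (x == p.1)%:R * tbd R y p.2 * c (tuple_join (p.1, p.2)))).
  rewrite -(pair_bigA _ (fun x' y' => tbd R x x' * (y == y')%:R * c (tuple_join (x', y'))
    + (-1) ^+ size (tuple_seq x') * (x == x')%:R * tbd R y y' * c (tuple_join (x', y')))) /=.
  under eq_bigr do rewrite big_split.
  rewrite big_split; congr (_ + _).
    apply: eq_bigr => x' _; under eq_bigr do rewrite -mulrA.
    by rewrite -mulr_sumr sum_deltal.
  rewrite exchange_big mulr_sumr; apply: eq_bigr => y' _ /=.
  under eq_bigr do rewrite [_ ^+ _ * _]mulrC -!mulrA.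
  by rewrite sum_deltal.
case=> x' y' _; rewrite -mulrDl; congr (_ * _); rewrite /tbd !tuple_joinE.
have [a xa] := tuple_alen x; have [b yb] := tuple_alen y.
have [a' xa'] := tuple_alen x'; have [b' yb'] := tuple_alen y'.
by rewrite (bd_cat_join xa yb xa' yb') !(inj_eq (@tuple_seq_inj _)).
Qed.

(** Taking [K] only isomorphic to the join covers the join itself and also the cone, whose vertex
    type is [option G]. *)
Lemma regularly_diagonal_join_iso :
  regularly_diagonal G R -> regularly_diagonal H R -> regularly_diagonal K R.
Proof.
move=> /regularly_diagonalP exG /regularly_diagonalP exH.
apply/regularly_diagonalP=> c dc c0.
have [|x x'||y y'|x y|x y x0 y0|w wE] := @exact_above0_tensor R (tuples G) (tuples H)
  (@tbd G R) (@excess G) (fun x => (-1) ^+ size (tuple_seq x)) (@tbd H R) (@excess H)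
  _ _ _ _ (fun x y => c (tuple_join (x, y))) exG exH.
- by move=> x; rewrite -expr2 sqrr_sign.
- have [->|/eqP/(tbd_size R) ->] := eqVneq (size (tuple_seq x')) (size (tuple_seq x)).+1.
    by rewrite exprS mulN1r mulrN mulrC.
  by rewrite mul0r mulr0 oppr0.
- exact: tbd_tbd.
- exact: tbd_excess.
- by rewrite -sum_tbd_join dc.
- by apply: c0; rewrite excess_tuple_join x0 y0.
have [psi psiK Kpsi] := tuple_join_bij; exists (fun z => w (psi z).1 (psi z).2) => z.
rewrite -[z]Kpsi; case: (psi z) => x y; rewrite sum_tbd_join -wE.
by under eq_bigr do rewrite psiK; under [X in _ + _ * X]eq_bigr do rewrite psiK.
Qed.

End Join.

(** * The one-point digraph and the cone *)

Definition point : digraph := Digraph (fun _ _ : unit => false).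

Lemma gen_point_eq k l : gen point k l -> k = l.
Proof.
move=> t; have := max_card (mem (gen_seq t)).
rewrite (card_uniqP (gen_uniq t)) size_gen card_unit ltnS leqn0 => /eqP k0; subst k.
have := gen_alen t; case: (gen_seq t) (size_gen t) => [|x []] // _.
by rewrite /alen /= => -[<-].
Qed.

(** The only generator is the single vertex, of degree and length 0, so off the diagonal the chain
    modules themselves vanish. *)
Lemma regularly_diagonal_point (R : comPzRingType) : regularly_diagonal point R.
Proof.
move=> k l kl; apply/homology_eq0P => u _; exists 0; rewrite raddf0.
by apply/ffunP=> t; case: kl; exact: gen_point_eq t.
Qed.

Theorem mainTheorem4 (R : comPzRingType) :
  (forall G H : digraph,
     regularly_diagonal G R -> regularly_diagonal H R ->
     regularly_diagonal (join G H) R) /\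
  (forall G : digraph,
     regularly_diagonal G R -> regularly_diagonal (cone G) R).
Proof.
split=> [G H dG dH|G dG].
  by apply: (@regularly_diagonal_join_iso R G H (join G H) id) => //; exists id.
(* The point becomes the apex; neither carries a loop. *)
pose phi (a : G + point) : cone G := if a is inl x then Some x else None.
apply: (@regularly_diagonal_join_iso R G point (cone G) phi) => //.
- exists (fun a : cone G => if a is Some x then inl x else inr tt).
    by case=> // -[].
  by case.
- by case=> [x|[]] [y|[]].
- exact: regularly_diagonal_point.
Qed.
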